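(* Let $\mathfrak{g}$ be a Lie algebra, let $M$ be a left $\mathfrak{g}$-module considered as a symmetric Leibniz $\mathfrak{g}$-bimodule $M_s$, and let $n$ be a non-negative integer. If $\mathrm{H}^k(\mathfrak{g},M)=0$ for every integer $k$ with $0\le k\le n$, then $\mathrm{HL}^k(\mathfrak{g},M_s)=0$ for every integer $k$ with $0\le k\le n$, and $\mathrm{HL}^{n+1}(\mathfrak{g},M_s)\cong\mathrm{H}^{n+1}(\mathfrak{g},M)$ as well as $\mathrm{HL}^{n+2}(\mathfrak{g},M_s)\cong\mathrm{H}^{n+2}(\mathfrak{g},M)$. In particular, $\mathrm{H}^\bullet(\mathfrak{g},M)=0$ implies $\mathrm{HL}^\bullet(\mathfrak{g},M_s)=0$.
   Context: $\mathrm{H}^\bullet(\mathfrak{g},M)$ denotes Chevalley–Eilenberg cohomology. A Lie algebra is regarded as a left Leibniz algebra with product $xy=[x,y]$; $M_s$ is $M$ with the given left action and right action $m\cdot x:=-x\cdot m$. $\mathrm{HL}^n(\mathfrak{g},M_s)$ is the cohomology of $\mathrm{CL}^n(\mathfrak{g},M_s)=\mathrm{Hom}(\mathfrak{g}^{\otimes n},M)$ with $(\mathrm{d}^nf)(x_1,\dots,x_{n+1})=\sum_{i=1}^n(-1)^{i+1}x_i\cdot f(\dots,\hat{x}_i,\dots)+(-1)^{n+1}f(x_1,\dots,x_n)\cdot x_{n+1}+\sum_{i<j}(-1)^if(x_1,\dots,\hat{x}_i,\dots,x_ix_j,\dots,x_{n+1})$ ($x_ix_j$ in the $j$-th position). 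*)

(* Defs.v *)
From HB Require Import structures.
From mathcomp Require Import all_boot all_algebra.
Set Implicit Arguments. Unset Strict Implicit. Unset Printing Implicit Defensive.
Import GRing.Theory.
Local Open Scope ring_scope.

(* Cochains of degree n are functions  seq g -> M  evaluated only on
   lists of length n (x_0, ..., x_(n-1)); indices are 0-based. *)

Section LieCohomology.
Variables (K : fieldType) (g M : lmodType K).

Definition is_lie_bracket (br : g -> g -> g) : Prop :=
  [/\ (forall (a : K) x y z, br (a *: x + y) z = a *: br x z + br y z),
      (forall (a : K) x y z, br z (a *: x + y) = a *: br z x + br z y),
      (forall x, br x x = 0) &
      (forall x y z, br x (br y z) + br y (br z x) + br z (br x y) = 0)].

Definition is_lie_module (br : g -> g -> g) (act : g -> M -> M) : Prop :=
  [/\ (forall (a : K) x y m, act (a *: x + y) m = a *: act x m + act y m),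
      (forall (a : K) x m m', act x (a *: m + m') = a *: act x m + act x m') &
      (forall x y m, act (br x y) m = act x (act y m) - act y (act x m))].

Definition delete (i : nat) (xs : seq g) : seq g := take i xs ++ drop i.+1 xs.

Definition multilinear (n : nat) (f : seq g -> M) : Prop :=
  forall (xs : seq g) (i : nat) (a : K) (u v : g), size xs = n -> (i < n)%N ->
    f (set_nth 0 xs i (a *: u + v)) = a *: f (set_nth 0 xs i u) + f (set_nth 0 xs i v).

Definition alternating (n : nat) (f : seq g -> M) : Prop :=
  forall (xs : seq g) (i j : nat), size xs = n -> (i < j)%N -> (j < n)%N ->
    nth 0 xs i = nth 0 xs j -> f xs = 0.

Definition CE_cochain (n : nat) (f : seq g -> M) : Prop :=
  multilinear n f /\ alternating n f.

Definition L_cochain (n : nat) (f : seq g -> M) : Prop := multilinear n f.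

Variables (br : g -> g -> g) (act : g -> M -> M).

Definition d_CE (n : nat) (f : seq g -> M) (xs : seq g) : M :=
  \sum_(i < n.+1) (-1) ^+ i *: act (nth 0 xs i) (f (delete i xs))
  + \sum_(j < n.+1) \sum_(i < j)
      (-1) ^+ (i + j) *: f (br (nth 0 xs i) (nth 0 xs j) :: delete i (delete j xs)).

(* Leibniz differential for M_s (right action m . x := - x . m, product xy = [x,y]),
   the context's formula with 0-based indices *)
Definition d_L (n : nat) (f : seq g -> M) (xs : seq g) : M :=
  \sum_(i < n) (-1) ^+ i *: act (nth 0 xs i) (f (delete i xs))
  + (-1) ^+ n.+1 *: (- act (nth 0 xs n) (f (take n xs)))
  + \sum_(j < n.+1) \sum_(i < j)
      (-1) ^+ i.+1 *: f (delete i (set_nth 0 xs j (br (nth 0 xs i) (nth 0 xs j)))).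

Definition cocycle (C : nat -> (seq g -> M) -> Prop)
    (D : nat -> (seq g -> M) -> seq g -> M) (n : nat) (f : seq g -> M) : Prop :=
  C n f /\ forall xs, size xs = n.+1 -> D n f xs = 0.

Definition coboundary (C : nat -> (seq g -> M) -> Prop)
    (D : nat -> (seq g -> M) -> seq g -> M) (n : nat) (f : seq g -> M) : Prop :=
  C n f /\
  match n with
  | 0 => forall xs, size xs = 0%N -> f xs = 0
  | k.+1 => exists h, C k h /\ forall xs, size xs = n -> f xs = D k h xs
  end.

Definition H_vanish C D (n : nat) : Prop :=
  forall f, cocycle C D n f -> coboundary C D n f.

Definition fsub (f f' : seq g -> M) : seq g -> M := fun xs => f xs - f' xs.
Definition fcomb (a : K) (f f' : seq g -> M) : seq g -> M :=
  fun xs => a *: f xs + f' xs.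

(* A K-linear isomorphism Z1^n/B1^n ~= Z2^n/B2^n, presented on
   representatives: phi maps cocycles to cocycles, is linear modulo
   coboundaries, induces a well-defined injective map on classes, and is
   surjective on classes. *)
Definition H_iso C1 D1 C2 D2 (n : nat) : Prop :=
  exists phi : (seq g -> M) -> (seq g -> M),
  [/\ (forall f, cocycle C1 D1 n f -> cocycle C2 D2 n (phi f)),
      (forall (a : K) f f', cocycle C1 D1 n f -> cocycle C1 D1 n f' ->
         coboundary C2 D2 n (fsub (phi (fcomb a f f')) (fcomb a (phi f) (phi f')))),
      (forall f f', cocycle C1 D1 n f -> cocycle C1 D1 n f' ->
         (coboundary C1 D1 n (fsub f f') <-> coboundary C2 D2 n (fsub (phi f) (phi f')))) &
      (forall f', cocycle C2 D2 n f' ->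
         exists f, cocycle C1 D1 n f /\ coboundary C2 D2 n (fsub (phi f) f'))].

End LieCohomology.

(* Main.v *)
(** Filter the Leibniz complex CL by F_p, the cochains that are alternating in their first p
    arguments: F_1 = CL, and in degree n one has F_p = CE (the Chevalley-Eilenberg cochains)
    as soon as p >= n. The Cartan formula i_x d + d i_x = L_x shows that d preserves F_p, and
    that on the quotient F_p / F_(p+1) it acts, up to sign, only on the arguments following
    the first p+1. As K is a field, d has a linear section on the coboundaries (Zorn); when
    HL^q = 0, applying it after the first p+1 arguments kills the degree p+1+q cohomology of
    F_p / F_(p+1). Hence CL / CE is acyclic in all degrees k such that HL^q = 0 for every
    q <= k - 2, so the inclusion of CE into CL induces isomorphisms on cohomology in the
    required range. *)

Require Import Defs.
From mathcomp Require Import all_boot all_algebra boolp classical_sets functions zify.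
Set Implicit Arguments. Unset Strict Implicit. Unset Printing Implicit Defensive.
Import GRing.Theory.
Local Open Scope ring_scope.

(** * Linear selections from linear relations *)

(** Zorn's lemma on graphs of partial linear maps that respect [R] wherever [R] has a value: over a
    field a maximal one is total, since a missing vector can be adjoined. [P] also controls the
    values outside the domain of [R]. *)
Lemma linear_selection (K : fieldType) (W V : lmodType K)
    (R : W -> V -> Prop) (P : V -> Prop) :
    R 0 0 ->
    (forall a w w' v v', R w v -> R w' v' -> R (a *: w + w') (a *: v + v')) ->
    P 0 -> (forall a v v', P v -> P v' -> P (a *: v + v')) ->
    (forall w v, R w v -> P v) ->
  exists s : W -> V,
    [/\ forall a w w', s (a *: w + w') = a *: s w + s w',
        forall w, P (s w) &
        forall w v, R w v -> R w (s w)].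
Proof.
move=> R0 Rlin P0 Plin RP.
pose good (A : set (W * V)) := [/\
  forall a w w' v v', A (w, v) -> A (w', v') -> A (a *: w + w', a *: v + v'),
  forall w v v', A (w, v) -> A (w, v') -> v = v',
  forall w v, A (w, v) -> (exists v', R w v') -> R w v &
  forall w v, A (w, v) -> P v].
have [A [[Alin Afun AR AP] Amax]] : exists A, good A /\
    forall B, (A `<` B)%classic -> ~ good B.
  apply: Zorn_bigcup => F Fgood Ftot.
  have join x y : (\bigcup_(X in F) X)%classic x ->
      (\bigcup_(X in F) X)%classic y -> exists X, [/\ F X, X x & X y].
    move=> [X FX Xx] [Y FY Yy].
    case: (Ftot X Y FX FY) => sub; [exists Y | exists X]; split=> //; exact: sub.
  split.
  - move=> a w w' v v' Aw Aw'; have [X [FX Xw Xw']] := join _ _ Aw Aw'.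
    by exists X => //; have [Xlin _ _ _] := Fgood X FX; apply: Xlin.
  - move=> w v v' Aw Aw'; have [X [FX Xw Xw']] := join _ _ Aw Aw'.
    by have [_ Xfun _ _] := Fgood X FX; apply: Xfun Xw Xw'.
  - by move=> w v [X FX Xw]; have [_ _ XR _] := Fgood X FX; apply: XR.
  - by move=> w v [X FX Xw]; have [_ _ _ XP] := Fgood X FX; apply: XP Xw.
have {}Amax B : (A `<=` B)%classic -> good B -> (B `<=` A)%classic.
  by move=> AB Bgood; apply: contrapT => nBA; apply: (Amax B).
have A00 : A (0, 0).
  (* The empty graph is [good], so a maximal [A] has to be compared with the graph of the zero map
     on 0. *)
  have [[[w v] Aw]|nA] := pselect (exists x, A x).
    by have := Alin (-1) _ _ _ _ Aw Aw; rewrite !scaleN1r !addNr.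
  apply: (Amax [set (0, 0)]%classic) => //.
    by move=> x Ax; case: nA; exists x.
  split.
  - by move=> a w w' v v' [-> ->] [-> ->]; rewrite !scaler0 !addr0.
  - by move=> w v v' [_ ->] [_ ->].
  - by move=> w v [-> ->].
  - by move=> w v [_ ->].
have domA w : exists v, A (w, v).
  apply: contrapT => nAw.
  (* Preferably adjoin a vector in the domain of [R], with one of its [R]-values. If [A] already
     covers that domain, [w] can be sent to 0: no [a *: w + w1] with [a] nonzero and [w1] in the
     domain of [A] lies in the domain of [R]. *)
  have [w0 [v0 [nAw0 Pv0 Rw0]]] : exists w0 v0,
      [/\ ~ (exists v, A (w0, v)), P v0 & forall a w1 v1, A (w1, v1) ->
      (exists v', R (a *: w0 + w1) v') -> R (a *: w0 + w1) (a *: v0 + v1)].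
    have [[w0 [nA0 [v0 R0v]]]|domR] := pselect (exists w0,
        ~ (exists v, A (w0, v)) /\ exists v, R w0 v).
      exists w0, v0; split=> //; first exact: RP R0v.
      move=> a w1 v1 Aw1 [v' Rv']; apply: (Rlin) => //; apply: AR => //.
      exists (- a *: v0 + v').
      by rewrite -[w1](addKr (a *: w0)) -scaleNr; apply: Rlin.
    exists w, 0; split=> // a w1 v1 Aw1 [v' Rv'].
    have [v'' Aww] : exists v, A (a *: w + w1, v).
      by apply: contrapT => nA; apply: domR; exists (a *: w + w1); split=> //; exists v'.
    have [a0|a0] := eqVneq a 0.
      rewrite a0 !scale0r !add0r in Rv' *.
      by apply: AR => //; exists v'.
    case: nAw; exists (a^-1 *: (-1 *: v1 + v'') + 0).
    have := Alin a^-1 _ _ _ _ (Alin (-1) _ _ _ _ Aw1 Aww) A00.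
    by rewrite !addr0 scaleN1r addrCA addNr addr0 scalerA mulVf // scale1r.
  apply: (nAw0); exists v0.
  apply: (Amax [set x | exists a w1 v1, A (w1, v1) /\
                 x = (a *: w0 + w1, a *: v0 + v1)]%classic); last 1 first.
  - by exists 1, 0, 0; rewrite !scale1r !addr0.
  - by move=> [w1 v1] Aw1; exists 0, w1, v1; rewrite !scale0r !add0r.
  split.
  - move=> a _ _ _ _ [b [w1 [v1 [A1 [-> ->]]]]] [c [w2 [v2 [A2 [-> ->]]]]].
    exists (a * b + c), (a *: w1 + w2), (a *: v1 + v2); split; first exact: Alin.
    by rewrite !scalerDr !scalerDl !scalerA !addrA; congr (_, _);
      congr (_ + _); rewrite addrAC.
  - move=> _ _ _ [b [w1 [v1 [A1 [-> ->]]]]] [c [w2 [v2 [A2 [eqw ->]]]]].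
    (* Two decompositions with different coefficients of [w0] would put [w0] in the domain of
       [A]. *)
    have [ebc|nbc] := eqVneq b c.
      rewrite ebc in eqw *; move/addrI: eqw => e; congr (_ + _).
      by apply: Afun A1 _; rewrite e.
    case: nAw0; exists ((b - c)^-1 *: (-1 *: v1 + v2) + 0).
    have := Alin (b - c)^-1 _ _ _ _ (Alin (-1) _ _ _ _ A1 A2) A00.
    rewrite addr0 !scaleN1r.
    have -> : - w1 + w2 = (b - c) *: w0.
      rewrite scalerBl; apply: (addrI w1).
      by rewrite addrA subrr add0r addrA [w1 + _]addrC eqw addrAC subrr add0r.
    by rewrite scalerA mulVf ?scale1r // subr_eq0.
  - by move=> _ _ [b [w1 [v1 [A1 [-> ->]]]]]; apply: Rw0.
  - move=> _ _ [b [w1 [v1 [A1 [_ ->]]]]]; apply: Plin => //; exact: AP A1.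
have [s As] := choice domA.
exists s; split.
- by move=> a w w'; apply: Afun (As _) _; apply: Alin.
- by move=> w; apply: AP (As w).
- by move=> w v Rwv; apply: AR => //; exists v.
Qed.

(** * The bracket, the action and multilinear cochains *)

Section LeibnizCochains.
Variables (K : fieldType) (g M : lmodType K).
Variables (br : g -> g -> g) (act : g -> M -> M).
Hypotheses (Hlie : is_lie_bracket br) (Hmod : is_lie_module br act).

Implicit Types (f h : seq g -> M) (x y z : g) (s t : seq g) (a : K).

Lemma brDl a x y z : br (a *: x + y) z = a *: br x z + br y z.
Proof. by have [H _ _ _] := Hlie. Qed.

Lemma brDr a x y z : br z (a *: x + y) = a *: br z x + br z y.
Proof. by have [_ H _ _] := Hlie. Qed.

Lemma brxx x : br x x = 0.
Proof. by have [_ _ H _] := Hlie. Qed.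

Lemma br_anti x y : br x y = - br y x.
Proof.
apply/eqP; rewrite -addr_eq0; apply/eqP.
have := brxx (1 *: x + y).
by rewrite brDl !brDr !scale1r !brxx addr0 add0r addrC.
Qed.

Lemma br_leibniz x y z : br (br x y) z = br x (br y z) - br y (br x z).
Proof.
have [_ _ _ /(_ x y z)] := Hlie; rewrite (br_anti z (br x y)) (br_anti z x).
have -> : br y (- br x z) = - br y (br x z).
  have := brDr (-1) (br x z) 0 y; rewrite !addr0 !scaleN1r => ->.
  by have := brDr (-1) 0 0 y; rewrite scaler0 addr0 scaleN1r addNr => ->; rewrite addr0.
by move/eqP; rewrite subr_eq0 => /eqP.
Qed.

Lemma actDl a x y m : act (a *: x + y) m = a *: act x m + act y m.
Proof. by have [H _ _] := Hmod. Qed.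

Lemma actDr a x m m' : act x (a *: m + m') = a *: act x m + act x m'.
Proof. by have [_ H _] := Hmod. Qed.

Lemma act0 x : act x 0 = 0.
Proof. by have := actDr (-1) x 0 0; rewrite scaler0 addr0 scaleN1r addNr. Qed.

Lemma act_br x y m : act (br x y) m = act x (act y m) - act y (act x m).
Proof. by have [_ _ H] := Hmod. Qed.

(** Concatenation replaces [set_nth], so that inductions on the list pass to [ins x f];
    [multilinearP] gives the equivalence. In degree 0 the condition is void. *)
Definition slotlinear n f := forall s1 s2 a x y, (size s1 + size s2).+1 = n ->
  f (s1 ++ (a *: x + y) :: s2) = a *: f (s1 ++ x :: s2) + f (s1 ++ y :: s2).

Definition ins x f : seq g -> M := fun s => f (x :: s).

Lemma slotlinear_ins n x f : slotlinear n.+1 f -> slotlinear n (ins x f).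
Proof. by move=> fl s1 s2 a y z sz; apply: (fl (x :: s1)); rewrite /= addSn sz. Qed.

Lemma slotlinear_comb n a f f' :
  slotlinear n f -> slotlinear n f' -> slotlinear n (fcomb a f f').
Proof.
move=> fl fl' s1 s2 b x y sz; rewrite /fcomb fl // fl' // !scalerDr !scalerA.
by rewrite mulrC addrACA.
Qed.

Lemma slotlinear0 n : slotlinear n (fun=> 0).
Proof. by move=> *; rewrite scaler0 addr0. Qed.

Lemma slotlinear_scale n a f : slotlinear n f -> slotlinear n (fun s => a *: f s).
Proof.
by move=> fl s1 s2 b x y sz; rewrite fl // scalerDr !scalerA mulrC.
Qed.

Lemma slotlinear_sub n f f' :
  slotlinear n f -> slotlinear n f' -> slotlinear n (fsub f f').
Proof.
move=> fl fl'; have -> : fsub f f' = fcomb (-1) f' f.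
  by apply: funext => s; rewrite /fcomb scaleN1r addrC.
exact: slotlinear_comb.
Qed.

Section SlotLinear.
Variables (f : seq g -> M) (s1 s2 : seq g).
Hypothesis fl : slotlinear (size s1 + size s2).+1 f.

Lemma slotD x y : f (s1 ++ (x + y) :: s2) = f (s1 ++ x :: s2) + f (s1 ++ y :: s2).
Proof. by rewrite -[x in x + y]scale1r fl // scale1r. Qed.

Lemma slot0 : f (s1 ++ 0 :: s2) = 0.
Proof. by apply: (addrI (f (s1 ++ 0 :: s2))); rewrite -slotD !addr0. Qed.

Lemma slotN x : f (s1 ++ - x :: s2) = - f (s1 ++ x :: s2).
Proof. by apply/eqP; rewrite -addr_eq0 -slotD addNr slot0. Qed.
End SlotLinear.

(** * Cartan calculus on Leibniz cochains *)

(* [lie_der x] is the Lie derivative L_x, and [leib_d] is the Leibniz differential, defined by the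
   Cartan formula i_x d = L_x - d i_x, with i_x = [ins x]. *)
Fixpoint lie_der x f s : M :=
  if s is y :: s' then lie_der x (ins y f) s' - f (br x y :: s')
  else act x (f [::]).

Fixpoint leib_d f s : M :=
  if s is x :: s' then lie_der x f s' - leib_d (ins x f) s' else 0.

Lemma lie_der_comb a f f1 f2 x s :
    (forall t, size t = size s -> f t = a *: f1 t + f2 t) ->
  lie_der x f s = a *: lie_der x f1 s + lie_der x f2 s.
Proof.
elim: s f f1 f2 => [|y s IH] f f1 f2 ef /=; first by rewrite ef // actDr.
rewrite (IH _ (ins y f1) (ins y f2)); last by move=> t st; apply: ef; rewrite /= st.
by rewrite ef //= scalerBr opprD addrACA.
Qed.

Lemma leib_d_comb a f f1 f2 s :
    (forall t, (size t).+1 = size s -> f t = a *: f1 t + f2 t) ->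
  leib_d f s = a *: leib_d f1 s + leib_d f2 s.
Proof.
elim: s f f1 f2 => [|y s IH] f f1 f2 ef /=; first by rewrite scaler0 addr0.
rewrite (IH _ (ins y f1) (ins y f2)); last by move=> t st; apply: ef; rewrite /= st.
rewrite (@lie_der_comb a f f1 f2); last by move=> t st; apply: ef; rewrite /= st.
by rewrite scalerBr opprD addrACA.
Qed.

Lemma eq_leib_d f f' s :
  (forall t, (size t).+1 = size s -> f t = f' t) -> leib_d f s = leib_d f' s.
Proof.
move=> ef; rewrite (@leib_d_comb 0 f f' f') ?scale0r ?add0r // => t st.
by rewrite scale0r add0r ef.
Qed.

Lemma lie_der_eq0 f x s :
  (forall t, size t = size s -> f t = 0) -> lie_der x f s = 0.
Proof.
move=> f0; rewrite (@lie_der_comb (-1) f f f) ?scaleN1r ?addNr // => t st.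
by rewrite f0 // scaler0 addr0.
Qed.

Lemma leib_d_eq0 f s :
  (forall t, (size t).+1 = size s -> f t = 0) -> leib_d f s = 0.
Proof.
move=> f0; rewrite (@leib_d_comb (-1) f f f) ?scaleN1r ?addNr // => t st.
by rewrite f0 // scaler0 addr0.
Qed.

Lemma leib_dB f f' s : leib_d (fsub f f') s = leib_d f s - leib_d f' s.
Proof.
rewrite addrC -scaleN1r; apply: leib_d_comb => t _.
by rewrite scaleN1r addrC.
Qed.

Lemma leib_dZ a f s : leib_d (fun t => a *: f t) s = a *: leib_d f s.
Proof.
rewrite (@leib_d_comb a _ f (fun=> 0)) => [|t _]; last by rewrite addr0.
by rewrite [leib_d (fun=> 0) s]leib_d_eq0 ?addr0.
Qed.

Lemma lie_derB f f' x s : lie_der x (fsub f f') s = lie_der x f s - lie_der x f' s.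
Proof.
rewrite addrC -scaleN1r; apply: lie_der_comb => t _.
by rewrite scaleN1r addrC.
Qed.

Lemma lie_der_slotlinear n x f : slotlinear n f -> slotlinear n (lie_der x f).
Proof.
move=> fl s1 s2 a y z sz; subst n.
elim: s1 f fl => [|w s1 IH] f fl /=; last first.
  rewrite IH; last exact: slotlinear_ins.
  by rewrite (fl (br x w :: s1)) // scalerBr opprD addrACA.
rewrite (@lie_der_comb a _ (ins y f) (ins z f)); last first.
  by move=> t st; apply: (fl [::]); rewrite /= st.
by rewrite brDr (fl [::]) //= scalerBr opprD addrACA.
Qed.

Lemma lie_der_linear f a x y s : slotlinear (size s) f ->
  lie_der (a *: x + y) f s = a *: lie_der x f s + lie_der y f s.
Proof.
elim: s f => [|z s IH] f fl /=; first exact: actDl.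
rewrite IH; last exact: slotlinear_ins.
by rewrite brDl (fl [::]) //= scalerBr opprD addrACA.
Qed.

Lemma leib_d_slotlinear n f : slotlinear n f -> slotlinear n.+1 (leib_d f).
Proof.
move=> fl s1 s2 a y z [sz]; subst n.
elim: s1 f fl => [|w s1 IH] f fl /=.
  rewrite lie_der_linear // (@leib_d_comb a _ (ins y f) (ins z f)); last first.
    by move=> t st; apply: (fl [::]); rewrite /= st.
  by rewrite scalerBr opprD addrACA.
rewrite IH; last exact: slotlinear_ins.
by rewrite (lie_der_slotlinear w fl) // scalerBr opprD addrACA.
Qed.

(** The module axiom settles the empty list and the Jacobi identity each further argument; the terms
    where [x] and [y] act at different places cancel. *)
Lemma lie_der_comm f x y s : slotlinear (size s) f ->
  lie_der (br x y) f s = lie_der x (lie_der y f) s - lie_der y (lie_der x f) s.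
Proof.
elim: s f => [|z s IH] f fl; first exact: act_br.
have step u v : lie_der u (lie_der v f) (z :: s) =
    lie_der u (lie_der v (ins z f)) s - lie_der u (ins (br v z) f) s
    - (lie_der v (ins (br u z) f) s - f (br v (br u z) :: s)).
  by rewrite -lie_derB.
rewrite !step /= IH; last exact: slotlinear_ins.
have -> : f (br (br x y) z :: s) = f (br x (br y z) :: s) - f (br y (br x z) :: s).
  by rewrite br_leibniz (@slotD f [::]) // (@slotN f [::]).
set A := lie_der x (lie_der y _) s; set B := lie_der x (ins _ f) s.
set C := lie_der y (ins _ f) s; set A' := lie_der y (lie_der x _) s.
rewrite -[A - B - _]addrA -[A' - C - _]addrA -!opprD.
rewrite [- (A' - _)]opprD addrACA -[in RHS]opprD; congr (_ - _).
rewrite [B + (_ + _)]addrCA opprD addrACA subrr add0r opprD addrACA subrr add0r.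
by rewrite opprK addrC.
Qed.

(** Contract with the first argument y: by the Cartan formula and [L_x, i_y] = i_[x,y], the claim
    reduces to [lie_der_comm] and to the same claim for i_y f. *)
Lemma lie_der_leib_d f x s : slotlinear (size s).-1 f ->
  lie_der x (leib_d f) s = leib_d (lie_der x f) s.
Proof.
elim: s f => [|y s IH] f fl /=; first exact: act0.
have -> : lie_der x (ins y (leib_d f)) s =
    lie_der x (lie_der y f) s - lie_der x (leib_d (ins y f)) s.
  by rewrite -lie_derB.
have -> : leib_d (ins y (lie_der x f)) s =
    leib_d (lie_der x (ins y f)) s - leib_d (ins (br x y) f) s.
  by rewrite -leib_dB.
rewrite IH; last by case: s fl {IH} => [_ []|z s fl] //; apply: slotlinear_ins.
rewrite lie_der_comm //.
set A := lie_der x _ s; set B := lie_der y _ s; set C := leib_d _ s.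
set D := leib_d _ s.
by rewrite -[A - B - D]addrA opprD addrACA subrr add0r !opprD !opprK addrCA.
Qed.

(** By the Cartan formula i_x d d = L_x d - d L_x + d d i_x; L_x commutes with d, and the last term
    vanishes by induction. *)
Lemma leib_d_leib_d f s : slotlinear (size s).-2 f -> leib_d (leib_d f) s = 0.
Proof.
elim: s f => [|x s IH] f fl //=.
have -> : leib_d (ins x (leib_d f)) s =
    leib_d (lie_der x f) s - leib_d (leib_d (ins x f)) s.
  by rewrite -leib_dB.
rewrite IH; last by case: s fl {IH} => [|y [|z s]] fl; [case|case|apply: slotlinear_ins].
by rewrite subr0 lie_der_leib_d // subrr.
Qed.


(** * The filtration by cochains alternating in their first arguments *)

(** Membership in F_p. Adjacent equal entries suffice: for multilinear cochains with [p] equal to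
    the degree, [altfirst_far] recovers the full alternating property, in any characteristic. *)
Definition altfirst p n f := forall s1 x s2, ((size s1).+1 < p)%N ->
  (size s1 + size s2).+2 = n -> f (s1 ++ [:: x, x & s2]) = 0.

Lemma altfirst_ins p n x f : altfirst p.+1 n.+1 f -> altfirst p n (ins x f).
Proof.
move=> fa s1 y s2 lt_p sz; apply: (fa (x :: s1)) => //.
by rewrite /= addSn sz.
Qed.

Lemma altfirst_sub p n f f' :
  altfirst p n f -> altfirst p n f' -> altfirst p n (fsub f f').
Proof. by move=> fa fa' s1 x s2 lt_p sz; rewrite /fsub fa // fa' // subr0. Qed.

Lemma altfirst_swap p n f s1 x y s2 : slotlinear n f -> altfirst p n f ->
    ((size s1).+1 < p)%N -> (size s1 + size s2).+2 = n ->
  f (s1 ++ [:: x, y & s2]) = - f (s1 ++ [:: y, x & s2]).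
Proof.
move=> fl fa lt_p sz; subst n; apply/eqP; rewrite -addr_eq0; apply/eqP.
have := fa s1 (x + y) s2 lt_p erefl.
rewrite slotD; last by rewrite /= addnS.
rewrite -!(cat_rcons _ s1) !slotD ?size_rcons ?addSn // !cat_rcons.
by rewrite !fa // add0r addr0.
Qed.

Lemma lie_der_altfirst p n x f :
  slotlinear n f -> altfirst p n f -> altfirst p n (lie_der x f).
Proof.
move=> fl fa s1 y s2 lt_p sz; subst n.
elim: s1 p f fl fa lt_p => [|z s1 IH] [|p] f fl fa //= lt_p.
  rewrite lie_der_eq0 => [|t st]; last by apply: (fa [::]); rewrite /= ?st.
  (* The two terms with [br x y] in one of the equal places are opposite by antisymmetry. *)
  rewrite /ins (altfirst_swap (s1 := [::]) _ _ fl fa) //= sub0r opprK subrr //.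
rewrite (IH p) //; [|exact: slotlinear_ins|exact: altfirst_ins].
by rewrite sub0r (fa (br x z :: s1)) // oppr0.
Qed.

(* As [L_x, i_x] = i_[x,x] = 0, the Cartan formula shows that i_x i_x commutes with d. *)
Lemma leib_d_double p n f s1 x s2 : slotlinear n f -> altfirst p n f ->
    (size s1 < p)%N -> (size s1 + size s2).+1 = n ->
  leib_d f (s1 ++ [:: x, x & s2])
    = (-1) ^+ size s1 *: leib_d (fun t => f (s1 ++ [:: x, x & t])) s2.
Proof.
move=> fl fa lt_p sz; subst n.
elim: s1 p f fl fa lt_p => [|z s1 IH] [|p] f fl fa //= lt_p.
  rewrite brxx (@slot0 f [::]) // subr0 expr0 scale1r.
  by rewrite opprB addrCA subrr addr0.
rewrite (IH p) //; [|exact: slotlinear_ins|exact: altfirst_ins].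
rewrite (lie_der_altfirst _ fl fa) ?addSn ?addnS // sub0r.
by rewrite exprS mulN1r scaleNr.
Qed.

(** By [leib_d_double], d commutes up to sign with inserting a repeated pair, and [f] already
    vanishes on such a pair. *)
Lemma leib_d_altfirst p n f :
  slotlinear n f -> altfirst p n f -> altfirst p n.+1 (leib_d f).
Proof.
move=> fl fa s1 x s2 lt_p [sz].
rewrite (leib_d_double _ fl fa) //; last exact: ltnW.
rewrite leib_d_eq0 ?scaler0 // => t st; apply: fa => //.
by rewrite -addnS st.
Qed.

(** * Applying an operator after the first arguments *)

(* A cochain of degree [q] only matters on lists of size [q]; [truncate q] picks a canonical
   representative, so that equality of cochains becomes equality of functions. *)
Definition truncate q f s : M := if size s == q then f s else 0.

(** This is Hom(g^(⊗p), S) under the identification of Hom(g^(⊗(p+q)), M) with Hom(g^(⊗p),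
    Hom(g^(⊗q), M)); 0 is a default on lists that are too short. *)
Fixpoint lift_op (S : (seq g -> M) -> seq g -> M) q p f s : M :=
  match p, s with
  | 0, _ => S (truncate q f) s
  | p'.+1, x :: s' => lift_op S q p' (ins x f) s'
  | _.+1, [::] => 0
  end.

Section LiftOp.
Variables (S : (seq g -> M) -> seq g -> M) (q r : nat).
Hypothesis Slin : forall a f f', S (a *: f + f') = a *: S f + S f'.
Hypothesis Sml : forall f, slotlinear r (S f).

Lemma lift_op_comb p a f f1 f2 s :
    (forall t, size t = (p + q)%N -> f t = a *: f1 t + f2 t) ->
  lift_op S q p f s = a *: lift_op S q p f1 s + lift_op S q p f2 s.
Proof.
elim: p f f1 f2 s => [|p IH] f f1 f2 s ef /=.
  have -> : truncate q f = a *: truncate q f1 + truncate q f2.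
    apply: funext => t; rewrite addrfctE scalrfctE /truncate.
    by case: eqP => [st|_]; rewrite ?ef ?scaler0 ?addr0.
  by rewrite Slin.
case: s => [|x s]; first by rewrite scaler0 addr0.
by apply: IH => t st; apply: ef; rewrite /= st.
Qed.

Lemma lift_op_eq0 p f s :
  (forall t, size t = (p + q)%N -> f t = 0) -> lift_op S q p f s = 0.
Proof.
move=> f0; rewrite (@lift_op_comb p (-1) f f f) ?scaleN1r ?addNr // => t st.
by rewrite f0 // scaler0 addr0.
Qed.

(** Linearity in the first [p] arguments comes from that of [S], in the others from the values of
    [S]. *)
Lemma lift_op_slotlinear p f :
  slotlinear (p + q) f -> slotlinear (p + r) (lift_op S q p f).
Proof.
elim: p f => [|p IH] f fl; first exact: Sml.
case=> [|w s1] s2 a x y /= [sz].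
  by apply: lift_op_comb => t st; apply: (fl [::]); rewrite /= st.
by apply: IH => //; apply: slotlinear_ins.
Qed.

Lemma lift_op_altfirst k p f : (k <= p)%N ->
  altfirst k (p + q) f -> altfirst k (p + r) (lift_op S q p f).
Proof.
move=> le_kp fa s1 x s2 lt_k _.
elim: s1 k p f le_kp fa lt_k => [|w s1 IH] [|k] [|p] f //= le_kp fa lt_k.
  case: p => [|p] in le_kp fa *; first by rewrite leqNgt ltnS in le_kp; case: k lt_k le_kp {fa}.
  by rewrite /=; apply: lift_op_eq0 => t st; apply: (fa [::]); rewrite /= ?st.
by apply: (IH k) => //; apply: altfirst_ins.
Qed.

Lemma lift_op_cat s1 s2 f :
  lift_op S q (size s1) f (s1 ++ s2) = S (truncate q (fun t => f (s1 ++ t))) s2.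
Proof. by elim: s1 f => [|x s1 IH] f //=; rewrite IH. Qed.
End LiftOp.

(** * Acyclicity of the quotient CL / CE *)

(** For [q = 0] the truncated predecessor is harmless: [leib_d h [::]] is 0, so the conclusion says
    that [f] vanishes on the empty list. *)
Definition HL_vanish q := forall f, slotlinear q f ->
  (forall s, size s = q.+1 -> leib_d f s = 0) ->
  exists2 h, slotlinear q.-1 h & forall s, size s = q -> f s = leib_d h s.

(** [linear_selection] for the relation that [h] is a primitive of [f]. All values of [S] are kept
    multilinear, since [lift_op] will also apply [S] to cochains that are not cocycles. *)
Lemma HL_section q : HL_vanish q ->
  exists S : (seq g -> M) -> seq g -> M,
    [/\ forall a f f', S (a *: f + f') = a *: S f + S f',
        forall f, slotlinear q.-1 (S f) &
        forall f, slotlinear q f -> (forall s, size s = q.+1 -> leib_d f s = 0) ->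
          forall s, size s = q -> leib_d (S (truncate q f)) s = f s].
Proof.
move=> HLq.
pose R f h := slotlinear q.-1 h /\ forall s, size s = q -> f s = leib_d h s.
have [||||f h []//|S [Slin Sml SR]] := @linear_selection K _ _ R (slotlinear q.-1).
- by split=> [|s sz]; [exact: slotlinear0 | rewrite leib_d_eq0].
- move=> a f f' h h' [hl fh] [hl' fh']; split; first exact: slotlinear_comb.
  move=> s sz; rewrite addrfctE scalrfctE fh // fh' //; apply/esym.
  by apply: leib_d_comb.
- exact: slotlinear0.
- by move=> a h h'; apply: slotlinear_comb.
exists S; split=> // f fl fz s sz.
have [h hl fh] := HLq f fl fz.
have [|_ Sf] := SR (truncate q f) h.
  by split=> // t st; rewrite /truncate st eqxx fh.
by rewrite -Sf // /truncate sz eqxx.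
Qed.

(** The class of [f] modulo F_(p+1) is detected by the degree q cochains t -> f(s1, x, x, t) with s1
    of length p - 1. By [leib_d_double] they are cocycles, and [h] is built from linearly chosen
    primitives. *)
Lemma filtration_step p q f : (0 < p)%N -> HL_vanish q ->
    slotlinear (p.+1 + q) f -> altfirst p (p.+1 + q) f ->
    altfirst p.+1 (p.+1 + q).+1 (leib_d f) ->
  exists h, [/\ slotlinear (p + q) h, altfirst p (p + q) h &
    altfirst p.+1 (p.+1 + q) (fsub f (leib_d h))].
Proof.
move=> p_gt0 HLq fl fa dfa.
have coc s1 x : (size s1).+1 = p -> slotlinear q (fun t => f (s1 ++ [:: x, x & t])) /\
    forall s, size s = q.+1 -> leib_d (fun t => f (s1 ++ [:: x, x & t])) s = 0.
  move=> sp; split.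
    move=> t1 t2 a y z sz.
    have := fl (s1 ++ [:: x, x & t1]) t2 a y z; rewrite -!catA; apply.
    by rewrite size_cat /=; lia.
  move=> s sz; have := dfa s1 x s; rewrite (leib_d_double _ fl fa) //;
    try lia.
  move=> /(_ ltac:(lia) ltac:(lia)) /eqP.
  by rewrite scaler_eq0 signr_eq0 => /eqP.
(* For [q = 0] there is no cochain of degree q - 1 to lift: HL^0 = 0 already gives f(s1, x, x) = 0,
   and [h = 0] works. *)
case: q => [|q] in HLq fl fa dfa coc *.
  exists (fun=> 0); split; [exact: slotlinear0|by move=> *|].
  move=> s1 x s2; rewrite ltnS leq_eqVlt => /orP[/eqP sp sz|lt_p sz]; last first.
    by rewrite /fsub fa // leib_d_eq0 ?subr0.
  have [cl cz] := coc s1 x sp; have [h hl ch] := HLq _ cl cz.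
  move: sz; rewrite -sp addn0 => -[]; rewrite -[X in _ = X]addn0 => /addnI /eqP.
  by rewrite size_eq0 => /eqP ->; rewrite /fsub (ch [::]) //= leib_d_eq0 ?subr0.
have [S [Slin Sml SR]] := HL_section HLq.
(* The sign cancels the (-1)^(p-1) that [leib_d_double] produces for [s1] of length p - 1. *)
pose h s := (-1) ^+ p.+1 *: lift_op S q.+1 p.+1 f s.
have hl : slotlinear (p + q.+1) h.
  by rewrite addnS -addSn; apply/slotlinear_scale/lift_op_slotlinear.
have ha : altfirst p (p + q.+1) h.
  have lifta : altfirst p (p.+1 + q) (lift_op S q.+1 p.+1 f).
    exact: lift_op_altfirst.
  by move=> s1 x s2 lt_p sz; rewrite /h lifta ?scaler0 //; lia.
exists h; split=> // s1 x s2; rewrite ltnS leq_eqVlt => /orP[/eqP sp sz|lt_p sz].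
  have [cl cz] := coc s1 x sp.
  have lt_p : (size s1 < p)%N by rewrite -sp.
  rewrite /fsub (leib_d_double _ hl ha) //; last by lia.
  rewrite (@eq_leib_d _ (fun t => (-1) ^+ p.+1 *:
    S (truncate q.+1 (fun u => f (s1 ++ [:: x, x & u]))) t)); last first.
    move=> t _; rewrite /h -sp; congr (_ *: _).
    have -> : s1 ++ [:: x, x & t] = (s1 ++ [:: x; x]) ++ t by rewrite -catA.
    have -> : (size s1).+2 = size (s1 ++ [:: x; x]) by rewrite size_cat addn2.
    rewrite lift_op_cat.
    by congr (S (truncate _ _) _); apply: funext => u; rewrite -catA.
  rewrite leib_dZ (SR _ cl cz); last by lia.
  by rewrite scalerA -sp -exprD -signr_odd !addnS addnn /= odd_double scale1r subrr.
rewrite /fsub fa // (leib_d_altfirst hl ha) ?subr0 // sz; lia.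
Qed.

(** A relative cocycle of CL / CE is moved from F_p to F_(p+1) by [filtration_step] for p = 1, ...,
    n - 1, with q = n - p - 1 running from n - 2 down to 0. *)
Lemma relative_acyclic n f : (forall q, (q.+2 <= n)%N -> HL_vanish q) ->
    slotlinear n f -> altfirst n.+1 n.+1 (leib_d f) ->
  exists2 h, slotlinear n.-1 h & altfirst n n (fsub f (leib_d h)).
Proof.
move=> HLn fl dfa.
suff: forall p, (p <= n)%N ->
  exists2 h, slotlinear n.-1 h & altfirst p n (fsub f (leib_d h)) by apply.
elim=> [|p IH] lt_pn; first by exists (fun=> 0) => //; apply: slotlinear0.
have [h hl ha] := IH (ltnW lt_pn).
(* Passing from F_0 to F_1 costs nothing: [altfirst 1] is void. *)
case: p lt_pn {IH} ha => [|p] lt_pn ha; first by exists h.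
have [q def_n] : exists q, n = (p.+2 + q)%N by exists (n - p.+2)%N; rewrite subnKC.
subst n.
have [|||||h' [h'l h'a dh'a]] := @filtration_step p.+1 q (fsub f (leib_d h)).
- by [].
- by apply: HLn; rewrite addSn ltnS addSn ltnS leq_addl.
- exact/(slotlinear_sub fl)/leib_d_slotlinear.
- exact: ha.
- move=> s1 x s2 lt_p sz; rewrite leib_dB (dfa s1) //; last by lia.
  rewrite leib_d_leib_d ?subr0 // size_cat /= !addnS sz; exact: hl.
exists (fcomb 1 h' h); first exact: slotlinear_comb.
move=> s1 x s2 lt_p sz; rewrite -[RHS](dh'a s1 x s2) // /fsub.
rewrite (@leib_d_comb 1 (fcomb 1 h' h) h' h) // scale1r opprD.
by rewrite addrA addrAC.
Qed.

(** * Comparison with the explicit differentials, cochains and cohomology *)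

Lemma lie_derE x f s : lie_der x f s = act x (f s)
  - \sum_(j < size s) f (set_nth 0 s j (br x (nth 0 s j))).
Proof.
elim: s f => [|y s IH] f /=; first by rewrite big_ord0 subr0.
by rewrite IH big_ord_recl /= opprD addrAC addrA.
Qed.

(** Unrolling the Cartan recursion: L_x gives the terms with i = 0, and - d i_x gives the others,
    with indices shifted by one and hence the opposite sign. *)
Lemma leib_dE f s : leib_d f s =
  \sum_(i < size s) (-1) ^+ i *: act (nth 0 s i) (f (delete i s))
  + \sum_(j < size s) \sum_(i < j)
      (-1) ^+ i.+1 *: f (delete i (set_nth 0 s j (br (nth 0 s i) (nth 0 s j)))).
Proof.
elim: s f => [|x s IH] f /=; first by rewrite !big_ord0 addr0.
rewrite IH lie_derE !big_ord_recl big_ord0 add0r /= /delete /= drop0 scale1r.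
under [X in _ = _ + X]eq_bigr do rewrite big_ord_recl /= scaleN1r drop0.
rewrite big_split /= opprD addrACA -!sumrN -!addrA; congr (_ + _).
congr (_ + (_ + _)).
- by apply: eq_bigr => i _; rewrite /bump /= add1n exprS mulN1r scaleNr.
apply: eq_bigr => j _; rewrite -sumrN; apply: eq_bigr => i _.
by rewrite /bump /= add1n [in RHS]exprS mulN1r scaleNr.
Qed.

Lemma d_L_leib_d n f s : size s = n.+1 -> d_L br act n f s = leib_d f s.
Proof.
move=> sz; rewrite leib_dE sz /d_L; congr (_ + _).
(* The right action being the negative of the left one, the right-hand term is the missing summand i
   = n. *)
rewrite big_ord_recr /= exprS mulN1r scaleNr scalerN opprK; congr (_ + _ *: act _ (f _)).
by rewrite /delete drop_oversize ?sz // cats0.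
Qed.

Lemma move_front n f s1 x s2 : slotlinear n f -> altfirst n n f ->
    (size s1 + size s2).+1 = n ->
  f (s1 ++ x :: s2) = (-1) ^+ size s1 *: f (x :: s1 ++ s2).
Proof.
move=> fl fa; elim/last_ind: s1 s2 => [|s1 y IH] s2 sz; first by rewrite scale1r.
rewrite size_rcons in sz *.
rewrite !cat_rcons (altfirst_swap _ _ fl fa) ?IH /=; try lia.
by rewrite exprS mulN1r scaleNr.
Qed.

Lemma altfirst_far n f s1 x s2 s3 : slotlinear n f -> altfirst n n f ->
  (size s1 + size s2 + size s3).+2 = n -> f (s1 ++ x :: s2 ++ x :: s3) = 0.
Proof.
move=> fl fa; elim: s2 s1 => [|y s2 IH] s1 /= sz; first by apply: fa; lia.
rewrite (altfirst_swap _ _ fl fa) /= ?size_cat /=; try lia.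
by rewrite -(cat_rcons y) IH ?oppr0 // size_rcons; lia.
Qed.

Lemma delete_cat i s1 s2 : (i < size s1)%N -> delete i (s1 ++ s2) = delete i s1 ++ s2.
Proof.
move=> lt_i; rewrite /delete take_cat lt_i drop_cat -catA.
case: ltnP => // le_i; rewrite [drop _ s1]drop_oversize //.
have /eqP -> : (i.+1 - size s1 == 0)%N by rewrite subn_eq0.
by rewrite drop0.
Qed.

(** Once x_i is deleted, the bracket sits at place j - 1; moving it to the front turns the sign
    (-1)^(i+1) into (-1)^(i+j). *)
Lemma d_CE_leib_d n f s : slotlinear n f -> altfirst n n f -> size s = n.+1 ->
  d_CE br act n f s = leib_d f s.
Proof.
move=> fl fa sz; rewrite leib_dE sz /d_CE; congr (_ + _).
apply: eq_bigr => j _; apply: eq_bigr => i _.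
have lt_ij := ltn_ord i; have lt_jn := ltn_ord j.
have szj : size (take j s) = j by rewrite size_take sz lt_jn.
rewrite set_nthE sz lt_jn [delete j s]/delete.
rewrite !(delete_cat (s1 := take j s)) ?szj //.
have szd : size (delete i (take j s)) = j.-1.
  rewrite size_cat size_drop size_take szj lt_ij; lia.
rewrite (move_front _ fl fa) ?size_drop ?szd ?sz; last by lia.
have -> : (i + j = i.+1 + j.-1)%N by lia.
by rewrite exprD scalerA.
Qed.

Lemma set_nth_mid s1 x y s2 : set_nth 0 (s1 ++ x :: s2) (size s1) y = s1 ++ y :: s2.
Proof. by elim: s1 => //= z s1 ->. Qed.

Lemma multilinearP n f : multilinear n f <-> slotlinear n f.
Proof.
split=> fl.
  move=> s1 s2 a x y sz.
  have := fl (s1 ++ 0 :: s2) (size s1) a x y; rewrite !set_nth_mid; apply.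
    by rewrite size_cat addnS.
  by rewrite -sz ltnS leq_addr.
move=> s i a x y sz lt_in; rewrite !set_nthE sz lt_in; apply: fl.
rewrite size_take size_drop sz lt_in; lia.
Qed.

Lemma CE_cochainP n f : CE_cochain n f <-> slotlinear n f /\ altfirst n n f.
Proof.
split=> -[fl fa]; split; try exact/multilinearP.
  move=> s1 x s2 lt_n sz; apply: (fa _ (size s1) (size s1).+1) => //.
    by rewrite size_cat /= !addnS.
  by rewrite !nth_cat ltnn subnn ltnNge leqnSn subSnn.
move=> s i j sz lt_ij lt_jn eq_ij.
rewrite -[s](cat_take_drop i) (drop_nth 0) ?sz; last exact: ltn_trans lt_jn.
rewrite -[drop i.+1 s](cat_take_drop (j - i.+1)) drop_drop subnK //.
rewrite (drop_nth 0 (n := j)) ?sz // -eq_ij; apply: altfirst_far fl fa _.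
by rewrite !size_takel ?size_drop ?sz; lia.
Qed.

Lemma L_cocycleP n f : cocycle (@L_cochain K g M) (d_L br act) n f <->
  slotlinear n f /\ forall s, size s = n.+1 -> leib_d f s = 0.
Proof.
split=> -[fl fz]; split; try exact/multilinearP.
  by move=> s sz; rewrite -(d_L_leib_d f sz) fz.
by move=> s sz; rewrite d_L_leib_d ?fz.
Qed.

Lemma CE_cocycleP n f : cocycle (@CE_cochain K g M) (d_CE br act) n f <->
  [/\ slotlinear n f, altfirst n n f & forall s, size s = n.+1 -> leib_d f s = 0].
Proof.
split=> [[/CE_cochainP[fl fa] fz]|[fl fa fz]]; split=> //.
- by move=> s sz; rewrite -(d_CE_leib_d fl fa sz) fz.
- exact/CE_cochainP.
- by move=> s sz; rewrite d_CE_leib_d ?fz.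
Qed.

Lemma L_coboundaryP n f : slotlinear n f ->
  coboundary (@L_cochain K g M) (d_L br act) n f <->
  exists2 h, slotlinear n.-1 h & forall s, size s = n -> f s = leib_d h s.
Proof.
move=> fl; case: n fl => [|n] fl; split.
- move=> [_ f0]; exists (fun=> 0); first exact: slotlinear0.
  by move=> s sz; rewrite f0 // leib_d_eq0.
- move=> [h _ fh]; split; first exact/multilinearP.
  by move=> s /[dup] /fh -> /eqP; rewrite size_eq0 => /eqP ->.
- move=> [_ [h [/multilinearP hl fh]]]; exists h => // s sz.
  by rewrite fh // d_L_leib_d.
- move=> [h hl fh]; split; first exact/multilinearP.
  exists h; split; first exact/multilinearP.
  by move=> s sz; rewrite fh // d_L_leib_d.
Qed.

Lemma CE_coboundaryP n f : slotlinear n f -> altfirst n n f ->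
  coboundary (@CE_cochain K g M) (d_CE br act) n f <->
  exists h, [/\ slotlinear n.-1 h, altfirst n.-1 n.-1 h &
    forall s, size s = n -> f s = leib_d h s].
Proof.
move=> fl fa; case: n fl fa => [|n] fl fa; split.
- move=> [_ f0]; exists (fun=> 0); split=> //.
  by move=> s sz; rewrite f0 // leib_d_eq0.
- move=> [h [_ _ fh]]; split; first exact/CE_cochainP.
  by move=> s /[dup] /fh -> /eqP; rewrite size_eq0 => /eqP ->.
- move=> [_ [h [/CE_cochainP[hl ha] fh]]]; exists h; split=> // s sz.
  by rewrite fh // d_CE_leib_d.
- move=> [h [hl ha fh]]; split; first exact/CE_cochainP.
  exists h; split; first exact/CE_cochainP.
  by move=> s sz; rewrite fh // d_CE_leib_d.
Qed.

Lemma L_vanishP n : H_vanish (@L_cochain K g M) (d_L br act) n <-> HL_vanish n.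
Proof.
split=> HLn f.
  move=> fl fz; apply: (proj1 (L_coboundaryP fl)); apply: HLn.
  exact/L_cocycleP.
by move=> /L_cocycleP[fl fz]; apply/L_coboundaryP => //; apply: HLn.
Qed.

(** * Vanishing and isomorphisms in cohomology *)

(** Every Leibniz class in this range has an alternating representative: a cocycle is in particular
    a relative cocycle of CL / CE. *)
Lemma cocycle_mod_coboundary n f : (forall q, (q.+2 <= n)%N -> HL_vanish q) ->
    slotlinear n f -> (forall s, size s = n.+1 -> leib_d f s = 0) ->
  exists2 h, slotlinear n.-1 h & [/\ slotlinear n (fsub f (leib_d h)),
    altfirst n n (fsub f (leib_d h)) &
    forall s, size s = n.+1 -> leib_d (fsub f (leib_d h)) s = 0].
Proof.
move=> HLn fl fz; have [|h hl ha] := relative_acyclic HLn fl.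
  by move=> s1 x s2 _ sz; apply: fz; rewrite size_cat /= !addnS.
exists h => //; split=> //.
  case: n {HLn fz ha} => [|n] in fl hl *; first by move.
  exact/(slotlinear_sub fl)/leib_d_slotlinear.
by move=> s sz; rewrite leib_dB fz // leib_d_leib_d ?subr0 // sz.
Qed.

(** Strong induction on k: vanishing of HL below k - 1 gives an alternating representative, which is
    a coboundary because H^k = 0. *)
Lemma HL_vanish_of_H n :
    (forall k, (k <= n)%N -> H_vanish (@CE_cochain K g M) (d_CE br act) k) ->
  forall k, (k <= n)%N -> HL_vanish k.
Proof.
move=> Hn; elim/ltn_ind=> k IH le_kn f fl fz.
have [|h hl [f'l f'a f'z]] := cocycle_mod_coboundary _ fl fz.
  by move=> q lt_qk; apply: IH; lia.
have /(CE_coboundaryP f'l f'a)[h' [h'l _ fh']] := Hn k le_kn _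
  (proj2 (CE_cocycleP _ _) (And3 f'l f'a f'z)).
exists (fcomb 1 h h'); first exact: slotlinear_comb.
move=> s sz; rewrite (@leib_d_comb 1 _ h h') // -fh' // scale1r.
by rewrite /fsub addrC subrK.
Qed.

(** The isomorphism is induced by inclusion. Surjectivity uses [relative_acyclic] in degree n + 1,
    injectivity uses it in degree n. *)
Lemma H_iso_inclusion n : (forall q, (q.+2 <= n.+1)%N -> HL_vanish q) ->
  H_iso (@CE_cochain K g M) (d_CE br act) (@L_cochain K g M) (d_L br act) n.+1.
Proof.
move=> HLn; exists id; split.
- by move=> f /CE_cocycleP[fl _ fz]; apply/L_cocycleP.
- move=> a f f' /CE_cocycleP[fl _ _] /CE_cocycleP[f'l _ _].
  apply/L_coboundaryP; first by apply: slotlinear_sub; apply: slotlinear_comb.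
  exists (fun=> 0); first exact: slotlinear0.
  by move=> s _; rewrite /fsub subrr leib_d_eq0.
- move=> f f' /CE_cocycleP[fl fa _] /CE_cocycleP[f'l f'a _].
  have dl := slotlinear_sub fl f'l; have da := altfirst_sub fa f'a.
  rewrite (L_coboundaryP dl) (CE_coboundaryP dl da).
  split=> [[h [hl _ dh]]|[h hl dh]]; first by exists h.
  (* The differential of [h] is the alternating cochain f - f', so [h] is a relative cocycle and h -
     d h' is an alternating primitive. *)
  have [||h' h'l h'a] := @relative_acyclic n h _ hl.
  + by move=> q lt_qn; apply: HLn; apply: leqW.
  + move=> s1 x s2 lt_n sz; rewrite -dh ?da //.
    by rewrite size_cat /= !addnS.
  exists (fsub h (leib_d h')); split=> //.
    case: n {HLn fl fa f'l f'a dl da dh h'a} hl h'l => [|n] hl h'l; first by move.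
    exact/(slotlinear_sub hl)/leib_d_slotlinear.
  move=> s sz; rewrite dh // leib_dB leib_d_leib_d ?subr0 // sz.
  exact: h'l.
- move=> f /L_cocycleP[fl fz].
  have [h hl [f'l f'a f'z]] := cocycle_mod_coboundary HLn fl fz.
  exists (fsub f (leib_d h)); split; first exact/CE_cocycleP.
  apply/L_coboundaryP; first exact: slotlinear_sub.
  exists (fun s => -1 *: h s); first exact: slotlinear_scale.
  by move=> s _; rewrite leib_dZ scaleN1r /fsub addrAC subrr add0r.
Qed.

End LeibnizCochains.

Theorem theorem2p6 (K : fieldType) (g M : lmodType K)
    (br : g -> g -> g) (act : g -> M -> M)
    (Hlie : is_lie_bracket br) (Hmod : is_lie_module br act) :
  (forall n : nat,
     (forall k : nat, (k <= n)%N -> H_vanish (@CE_cochain K g M) (d_CE br act) k) ->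
     (forall k : nat, (k <= n)%N -> H_vanish (@L_cochain K g M) (d_L br act) k)
     /\ H_iso (@CE_cochain K g M) (d_CE br act) (@L_cochain K g M) (d_L br act) n.+1
     /\ H_iso (@CE_cochain K g M) (d_CE br act) (@L_cochain K g M) (d_L br act) n.+2)
  /\
  ((forall k : nat, H_vanish (@CE_cochain K g M) (d_CE br act) k) ->
   forall k : nat, H_vanish (@L_cochain K g M) (d_L br act) k).
Proof.
have HL n := HL_vanish_of_H Hlie Hmod (n := n).
split=> [n Hn|Hall k]; last first.
  by apply/(L_vanishP Hmod); exact: (HL k (fun j _ => Hall j) k (leqnn k)).
split=> [k le_kn|]; first by apply/(L_vanishP Hmod); exact: (HL n).
(* Degree n + 2 uses HL^q = 0 for all q <= n, the full range available; degree n + 1 uses only q <=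
   n - 1. *)
split; apply: (H_iso_inclusion Hlie Hmod) => q lt_q; apply: (HL n) => //.
exact: ltnW.
Qed.
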